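(* Let $f:[0,1]\to[0,1]$ be an overall and piecewise strictly monotonic continuously differentiable bijection. Then $f$ has the Costas property on $[0,1]$.
   Context: Costas property: a bijection $f:[0,1]\to[0,1]$ has the Costas property iff the multiset $\{(x-y,f(x)-f(y)):0\le y<x\le 1\}$ is actually a set, i.e. all of its elements are distinct (different pairs $(x,y)$ with $y<x$ give different vectors). Overall and piecewise strictly monotonic: there exist $n\in\{1,2,3,\dots\}\cup\{\infty\}$ and a sequence of intervals $\{I_i\}_{i=1}^n$ ($n=\infty$ meaning countably infinitely many intervals) with pairwise disjoint interiors and union $[0,1]$, such that, writing $\mathring{I_i}$ for the interior of $I_i$: (1) (piecewise strictly monotonic) for each $i$, $f$ is continuously differentiable in $\mathring{I_i}$ and the restriction of $f'$ to $\mathring{I_i}$ is strictly monotonic; (2) (overall strictly monotonic) either for all sequences of points $\{x_i\}_{i=1}^n$ with $x_i\in\mathring{I_i}$ for every $i$, the sequence $\{f'(x_i)\}_{i=1}^n$ is strictly increasing, or for all such sequences of points the sequence $\{f'(x_i)\}_{i=1}^n$ is strictly decreasing. *)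

(* Defs.v *)
From mathcomp Require Import all_boot all_order all_algebra.
From mathcomp Require Import all_classical all_reals all_analysis.

Set Implicit Arguments.
Unset Strict Implicit.
Unset Printing Implicit Defensive.
Import Order.TTheory GRing.Theory Num.Theory numFieldNormedType.Exports.
Local Open Scope ring_scope.
Local Open Scope classical_set_scope.

(* A function f : [0,1] -> [0,1] is represented by a function R -> R of which
   only the restriction to [0,1] matters. *)

Definition costas (R : realType) (f : R -> R) : Prop :=
  set_inj [set p : R * R | 0 <= p.2 /\ p.2 < p.1 /\ p.1 <= 1]
    (fun p => (p.1 - p.2, f p.1 - f p.2)).

(* g is the derivative of f relative to [0,1] (hence one-sided at 0 and 1);
   the library's f^`() would depend on the values of f outside [0,1]. *)
Definition continuously_differentiable01 (R : realType) (f : R -> R) : Prop :=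
  exists g : R -> R, {within `[0, 1], continuous g} /\
    forall x, `[0, 1] x ->
      (f y - f x) / (y - x) @[y --> within `[0, 1] x^'] --> g x.

Definition strictly_monotonic_on (R : realType) (A : set R) (g : R -> R) :
    Prop :=
  {in A &, {homo g : x y / x < y >-> x < y}} \/
  {in A &, {homo g : x y / x < y >-> x > y}}.

(* The index set is {0, ..., n-1} for a positive n, or all of nat (the case of
   infinitely many intervals). The intervals may be open, closed or half-open.
   They are required to be nondegenerate: an interval with empty interior would
   make the condition on sequences of interior points vacuous. *)
Definition overall_piecewise_strictly_monotonic (R : realType) (f : R -> R) :
    Prop :=
  exists (D : set nat) (I : nat -> set R),
    (D = setT \/ exists2 n, (0 < n)%N & D = `I_n) /\
    (forall i, D i -> is_interval (I i) /\ (I i)° !=set0) /\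
    trivIset D (fun i => (I i)°) /\
    \bigcup_(i in D) I i = `[0, 1] /\
    (forall i, D i ->
      (forall x, (I i)° x -> derivable f x 1) /\
      {within (I i)°, continuous f^`()} /\
      strictly_monotonic_on (I i)° f^`()) /\
    ((forall x : nat -> R, (forall i, D i -> (I i)° (x i)) ->
        {in D &, {homo (fun i => f^`() (x i)) : i j / (i < j)%N >-> i < j}}) \/
     (forall x : nat -> R, (forall i, D i -> (I i)° (x i)) ->
        {in D &, {homo (fun i => f^`() (x i)) : i j / (i < j)%N >-> i > j}})).

(* Main.v *)
(* The hypotheses on the sequences of interior points say that f' is injective
   on the union of the interiors of the intervals, whose complement in [0,1] is
   countable (endpoints of the intervals). Since f' is continuous on [0,1], it
   is then injective on all of [0,1]. If two different pairs gave the same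
   vector (d, e), then f(t + d) - f(t) would take the value e twice, so that
   f'(t + d) = f'(t) for some t, a contradiction. *)

Require Import Defs.
From mathcomp Require Import all_boot all_order all_algebra.
From mathcomp Require Import all_classical all_reals all_analysis.
From mathcomp Require Import lra.
Import Order.TTheory GRing.Theory Num.Theory.
Import numFieldNormedType.Exports.
Local Open Scope ring_scope.
Local Open Scope classical_set_scope.

(** A countable set is Lebesgue-null, while the interval has measure [b - a > 0]. *)
Lemma itvoo_notin_countable (R : realType) (N : set R) (a b : R) :
  countable N -> a < b -> exists2 x, a < x < b & ~ N x.
Proof.
move=> cN ab; apply: contrapT => nox.
have sub : `]a, b[%classic `<=` N.
  move=> x; rewrite /= in_itv /= => xab; apply: contrapT => Nx.
  by apply: nox; exists x.
have cab : countable `]a, b[%classic := sub_countable (subset_card_le sub) cN.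
have := countable_lebesgue_measure0 cab.
rewrite lebesgue_measure_itv /= lte_fin ab -EFinB => -[].
by move/eqP; rewrite subr_eq0 gt_eqF.
Qed.

(** The interior is the open interval from [inf X] to [sup X], so at most these two points are
    lost. *)
Lemma countable_interval_frontier (R : realType) (X : set R) :
  is_interval X -> has_lbound X -> has_ubound X -> countable (X `\` X°).
Proof.
move=> iX lX uX.
have sub : X `\` X° `<=` [set inf X; sup X].
  move=> x [Xx]; rewrite interval_bounded_interior //= => nx.
  have infx : inf X <= x by apply: ge_inf.
  have xsup : x <= sup X by apply: ub_le_sup.
  have [->|ninf] := eqVneq x (inf X); first by left.
  have [->|nsup] := eqVneq x (sup X); first by right.
  by exfalso; apply: nx; rewrite !lt_neqAle eq_sym ninf infx nsup xsup.
apply: sub_countable (subset_card_le sub) _.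
by apply: finite_set_countable; exact: finite_set2.
Qed.

(** A point of [A] in no interior is one that some [I i] loses on passing to its interior. Each
    [I i] inherits the bounds of [A], so it loses only countably many. *)
Lemma countable_bigcup_interior_compl (R : realType) (D : set nat)
    (I : nat -> set R) (A : set R) :
  has_lbound A -> has_ubound A -> \bigcup_(i in D) I i = A ->
  (forall i, D i -> is_interval (I i)) ->
  countable (A `\` \bigcup_(i in D) (I i)°).
Proof.
move=> [l lA] [u uA] UA iI.
have sub : A `\` \bigcup_(i in D) (I i)° `<=` \bigcup_(i in D) (I i `\` (I i)°).
  rewrite -UA => x [[i Di Iix] nx]; exists i => //; split => // Iox.
  by apply: nx; exists i.
apply: sub_countable (subset_card_le sub) _.
apply: bigcup_countable => // i Di.
apply: countable_interval_frontier; first exact: iI.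
- by exists l => x Ix; apply: lA; rewrite -UA; exists i.
- by exists u => x Ix; apply: uA; rewrite -UA; exists i.
Qed.

(* If [g x = g y] with [x < y], the intermediate value theorem makes [g] take
   an interval of values on both sides of some point [c] between them; one of
   these values is not in the countable set [g @` N]. *)
Lemma set_inj_cocountable (R : realType) (N : set R) (u v : R) (g : R -> R) :
  countable N -> {within `[u, v], continuous g} ->
  set_inj (`[u, v] `\` N) g -> set_inj `[u, v] g.
Proof.
move=> cN cg injg.
have inju x y : u <= x <= v -> u <= y <= v -> ~ N x -> ~ N y ->
    g x = g y -> x = y.
  by move=> xuv yuv Nx Ny; apply: injg; rewrite inE /= in_itv.
suff lt_neq (x y : R) : u <= x -> y <= v -> x < y -> g x <> g y.
  move=> x y; rewrite !inE /= !in_itv /= => /andP[ux xv] /andP[uy yv] gxy.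
  have [xy|yx|//] := ltgtP x y; first by case: (lt_neq x y).
  by case: (lt_neq y x).
move=> ux yv xy gxy.
(* Points off [N] chosen in the two halves of []x, y[] cannot both take the value [g x]. *)
have [c /andP[xc cy] gc] : exists2 c, x < c < y & g c != g x.
  have [m xmy] : exists m, x < m < y by exists ((x + y) / 2); lra.
  have /andP[xm my] := xmy.
  have [c1 c1P Nc1] := itvoo_notin_countable _ _ _ _ cN xm.
  have [c2 c2P Nc2] := itvoo_notin_countable _ _ _ _ cN my.
  have [gc1|] := eqVneq (g c1) (g x); last by exists c1 => //; lra.
  have [gc2|] := eqVneq (g c2) (g x); last by exists c2 => //; lra.
  suff : c1 = c2 by lra.
  by apply: inju; [lra|lra|by []|by []|rewrite gc1 gc2].
have : Num.min (g x) (g c) < Num.max (g x) (g c).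
  by rewrite minEle maxEle; case: (leP (g x)) => // ?; rewrite lt_neqAle eq_sym gc.
have cgN : countable (g @` N) by apply: sub_countable (card_image_le _ _) cN.
(* [w] lies strictly between [g x = g y] and [g c], and all its preimages are outside [N]. *)
move=> /(itvoo_notin_countable _ _ _ _ cgN)[w /andP[w1 w2] gNw].
have sub a b : u <= a -> b <= v -> {within `[a, b], continuous g}.
  move=> ua bv; apply: continuous_subspaceW cg => z /=; rewrite !in_itv /=; lra.
have [||d1 d1P gd1] := @IVT R g x c w (ltW xc).
- by apply: sub => //; lra.
- by rewrite !ltW.
have [||d2 d2P gd2] := @IVT R g c y w (ltW cy).
- by apply: sub => //; lra.
- by rewrite -gxy minC maxC !ltW.
rewrite !in_itv /= in d1P d2P.
have notN z : g z = w -> ~ N z by move=> gz Nz; apply: gNw; exists z.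
have d12 : d1 = d2.
  by apply: inju; [lra|lra|exact: notN|exact: notN|rewrite gd1 gd2].
(* Since [d1 <= c <= d2], all three coincide and [g c = w], against the strict choice of [w]. *)
have d1c : d1 = c by lra.
by move: w1 w2; rewrite -gd1 d1c minEle maxEle; case: ifP; rewrite ltxx.
Qed.

(** Near an interior point the restriction to [A] is vacuous; then substitute [y = h + x]. *)
Lemma is_derive_within (R : realType) (A : set R) (f : R -> R) (x l : R) :
  A° x -> (f y - f x) / (y - x) @[y --> within A x^'] --> l ->
  is_derive x 1 f l.
Proof.
move=> Ax /cvgrPdist_lt fl.
suff h : h^-1 *: ((f \o shift x) (h *: 1) - f x) @[h --> 0^'] --> l.
  by split; [apply/cvg_ex; exists l|apply: cvg_lim].
apply/cvgrPdist_lt => e e0.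
have near_quot : \forall y \near x, y != x ->
    `|l - (f y - f x) / (y - x)| < e.
  have := fl _ e0; rewrite !near_withinE => fe.
  have Anear : \forall y \near x, A y by exact: Ax.
  near=> y; move=> yx.
  have /(_ yx) : y != x -> A y -> `|l - (f y - f x) / (y - x)| < e by near: y.
  by apply; near: y.
have /nbhs_ballP[d /= d0 dP] := near_quot.
apply/nbhs_ballP; exists d => //= h; rewrite /ball /= sub0r normrN => hd h0.
have := dP (h + x); rewrite /ball /= opprD addrCA subrr addr0 normrN => /(_ hd).
have -> : h + x != x by rewrite -subr_eq0 addrK.
move=> /(_ isT); rewrite addrK.
by rewrite /GRing.scale /= mulr1 mulrC.
Unshelve. all: by end_near. Qed.

(** The increment of [f] is the quotient times [y - x], hence tends to [g x * 0]. *)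
Lemma continuous_within_quotient (R : realType) (A : set R) (f g : R -> R) :
  (forall x, A x -> (f y - f x) / (y - x) @[y --> within A x^'] --> g x) ->
  {within A, continuous f}.
Proof.
move=> fg; apply/subspace_continuousP => x Ax.
have id0 : (y - x) @[y --> within A x^'] --> 0.
  rewrite -(subrr x); apply: cvgB; last exact: cvg_cst.
  by apply: cvg_within_filter; apply: cvg_within.
have /cvgrPdist_lt f0 :
    (f y - f x) / (y - x) * (y - x) @[y --> within A x^'] --> (0 : R).
  by rewrite -(mulr0 (g x)); apply: cvgM => //; exact: fg.
apply/cvgrPdist_lt => e e0; have := f0 _ e0.
rewrite !near_withinE; apply: filterS => y fe Ay.
have [->|yx] := eqVneq y x; first by rewrite subrr normr0.
have := fe yx Ay.
by rewrite /= sub0r normrN divfK ?subr_eq0 // distrC.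
Qed.

(* Two equal vectors with first coordinate [d], based at [y] and [y'], give
   [t |-> f (t + d) - f t] equal values at [y] and [y']; apply Rolle to it. *)
Lemma set_inj_derivative_costas (R : realType) (f g : R -> R) :
  {within `[0, 1], continuous f} ->
  (forall x : R, 0 < x < 1 -> is_derive x 1 f (g x)) ->
  set_inj `[0, 1] g -> costas f.
Proof.
move=> cf df injg.
(* By symmetry [y < y'] may be assumed; if [y = y'], equal first coordinates already give
   [x = x']. *)
suff lt_false (x y x' y' : R) : 0 <= y -> y < x -> x' <= 1 -> y < y' ->
    x - y = x' - y' -> f x - f y = f x' - f y' -> False.
  move=> [x y] [x' y']; rewrite !inE /= => -[y0 [yx x1]] [y'0 [yx' x'1]] [dE fE].
  have [yy'|y'y|yy'] := ltgtP y y'.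
  - by case: (lt_false x y x' y').
  - by case: (lt_false x' y' x y).
  - by congr pair; lra.
move=> y0 yx x'1 yy' dE fE.
pose d := x - y; pose h t := f (t + d) - f t.
(* Both points are in []0, 1[], as [0 <= y < t < t + d < y' + d = x' <= 1]. *)
have dh t : t \in `]y, y'[%R -> is_derive t 1 h (g (t + d) - g t).
  rewrite in_itv /= => /andP[yt ty'].
  have d1 : is_derive t 1 f (g t) by apply: df; rewrite /d; lra.
  have d2 : is_derive (t + d) 1 f (g (t + d)) by apply: df; rewrite /d; lra.
  have ds : is_derive t 1 (fun s : R => s + d) 1.
    by rewrite -[X in is_derive _ _ _ X]addr0; apply: is_deriveD.
  have dc := @is_derive1_comp R f (fun s => s + d) t _ _ d2 ds.
  by rewrite mulr1 in dc; exact: is_deriveB.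
have [|||t ty [_ h0]] := @Rolle R h y y' yy'.
- by move=> t /dh [].
- have sub : {within `[y, y'], continuous f}.
    by apply: continuous_subspaceW cf => z /=; rewrite !in_itv /=; lra.
  (* Translation by [d] carries [[y, y']] onto [[x, x']], which is inside [[0, 1]]. *)
  move=> z; apply: (@cvgB _ _ _ _ _ (f \o (fun s => s + d)) f); last exact: sub.
  move: z; apply/subspace_continuousP => z /=; rewrite in_itv /= => zy.
  have /subspace_continuousP/(_ (z + d)) fzd := cf.
  apply: cvg_comp (fzd _); last by rewrite /= in_itv /= /d; lra.
  have shz : (s + d) @[s --> z] --> z + d.
    by apply: cvgD; [exact: cvg_id|exact: cvg_cst].
  move=> P /shz P01; change (\forall s \near z, `[y, y'] s -> P (s + d)).
  have {}P01 : \forall s \near z, `[0, 1] (s + d) -> P (s + d) by exact: P01.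
  apply: filterS P01 => s /= Ps; rewrite in_itv /= => sy.
  by apply: Ps; rewrite in_itv /= /d; lra.
- have yd : y + d = x by rewrite /d; lra.
  have y'd : y' + d = x' by rewrite /d; lra.
  by rewrite /h yd y'd.
have [_ ] := dh _ ty; rewrite h0 => /esym/eqP; rewrite subr_eq0 => /eqP gE.
move: ty; rewrite in_itv /= => ty.
have : t + d = t by apply: injg; rewrite ?inE /= ?in_itv /= /d //; lra.
by rewrite /d; lra.
Qed.

Theorem theorem4 (R : realType) (f : R -> R)
  (f_bij : set_bij `[0, 1] `[0, 1] f)
  (f_C1 : continuously_differentiable01 f)
  (f_mono : overall_piecewise_strictly_monotonic f) :
  costas f.
Proof.
have [g [cg fg]] := f_C1.
have [D [I [_ [iI [_ [UI [pI oI]]]]]]] := f_mono.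
have df (x : R) : 0 < x < 1 -> is_derive x 1 f (g x).
  move=> x01; apply: (is_derive_within _ `[0, 1]).
    by rewrite interior_itv_bnd /= in_itv.
  by apply: fg; rewrite /= in_itv /= !ltW //; lra.
apply: (set_inj_derivative_costas _ _ g) => //.
  exact: continuous_within_quotient fg.
pose U := \bigcup_(i in D) (I i)°.
apply: (@set_inj_cocountable R (`[0, 1] `\` U)) => //.
  apply: countable_bigcup_interior_compl => //.
  by move=> i Di; have [] := iI i Di.
(* The two-sided derivative is compared with [g] only inside []0, 1[], which contains every
   [(I i)°]. *)
have gE i (x : R) : D i -> (I i)° x -> g x = f^`() x.
  move=> Di Ix; rewrite derive1E.
  suff /df dfx : 0 < x < 1 by rewrite (@derive_val _ _ _ _ _ _ _ dfx).
  have : (`[0, 1] : set R)° x.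
    by apply: interiorS Ix => z Iz; rewrite -UI; exists i.
  by rewrite interior_itv_bnd /= in_itv.
rewrite setDD => x y; rewrite !inE => -[_ [i Di Ix]] [_ [j Dj Iy]].
rewrite (gE i) // (gE j) // => gxy.
(* The condition across intervals concerns whole sequences, so [s] and [t] are completed to one by
   points [z m] of the nonempty interiors; the default 0 serves only for indices outside [D]. *)
have mono_neq k l (s t : R) : D k -> D l -> (k < l)%N -> (I k)° s -> (I l)° t ->
    f^`() s <> f^`() t.
  move=> Dk Dl kl Is It.
  have /choice[z zI] : forall m, exists r : R, D m -> (I m)° r.
    move=> m; have [/iI[_ [r Ir]]|nD] := pselect (D m); first by exists r.
    by exists 0.
  pose w m := if m == k then s else if m == l then t else z m.
  have wI m : D m -> (I m)° (w m).
    rewrite /w; case: eqP => [->//|_]; case: eqP => [->//|_]; exact: zI.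
  have wk : w k = s by rewrite /w eqxx.
  have wl : w l = t by rewrite /w (gtn_eqF kl) eqxx.
  case: oI => /(_ w wI k l); rewrite !inE => /(_ Dk Dl kl); rewrite wk wl => lt st;
    by move: lt; rewrite st ltxx.
have [ij|ji|ij] := ltngtP i j.
- by case: (mono_neq i j x y).
- by case: (mono_neq j i y x).
subst j; have [_ [_ mono]] := pI i Di.
have mono_lt_neq (s t : R) : (I i)° s -> (I i)° t -> s < t ->
    f^`() s <> f^`() t.
  move=> Is It st fst; case: mono => /(_ s t); rewrite !inE => /(_ Is It st);
    by rewrite fst ltxx.
have [xy|yx|//] := ltgtP x y.
- by case: (mono_lt_neq x y).
- by case: (mono_lt_neq y x).
Qed.
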